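(* Consider the random triangle removal process on $n$ vertices. Suppose that for some fixed $0<\epsilon<\frac16$, all co-degrees satisfy $Y_{u,v}=(1+o(1))np^2$ throughout the times with $p\ge p_0=n^{-1/2+\epsilon}$. Then with high probability the final number of edges (the number of edges of the triangle-free graph at which the process terminates) is at least $n^{3/2-6\epsilon-o(1)}$.
   Context: Random triangle removal process: $G(0)=K_n$ on vertex set $V_G$, $|V_G|=n$; as long as $G(i)$ has a triangle, $G(i+1)$ is obtained by deleting the three edges of a uniformly random triangle of $G(i)$; the process terminates when the graph is triangle-free. $p=p(i)=1-6i/n^2$. For distinct vertices $u,v$, $Y_{u,v}$ is their co-degree in $G(i)$. Asymptotic notation refers to $n\to\infty$; ''with high probability'' means with probability tending to $1$. *)

(* Defs.v *)
From HB Require Import structures.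
From mathcomp Require Import all_boot all_order all_algebra.
From mathcomp Require Import all_classical all_reals all_analysis.
Set Implicit Arguments. Unset Strict Implicit. Unset Printing Implicit Defensive.
Import Order.TTheory GRing.Theory Num.Theory.
Import numFieldNormedType.Exports.
Local Open Scope ring_scope.

(* Graphs on vertex set 'I_n: a graph is its edge set, a set of 2-subsets. *)
Definition pairs_of (n : nat) (T : {set 'I_n}) : {set {set 'I_n}} :=
  [set e : {set 'I_n} | (e \subset T) && (#|e| == 2)%N].

Definition complete_graph (n : nat) : {set {set 'I_n}} :=
  [set e : {set 'I_n} | #|e| == 2%N].

Definition triangles (n : nat) (G : {set {set 'I_n}}) : {set {set 'I_n}} :=
  [set T : {set 'I_n} | (#|T| == 3)%N && (pairs_of T \subset G)].

Definition remove_tri (n : nat) (G : {set {set 'I_n}}) (T : {set 'I_n}) :=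
  G :\: pairs_of T.

Definition graph_after (n : nat) (s : seq {set 'I_n}) : {set {set 'I_n}} :=
  foldl (@remove_tri n) (complete_graph n) s.

Definition codeg (n : nat) (G : {set {set 'I_n}}) (u v : 'I_n) : nat :=
  #|[set w : 'I_n | ([set u; w] \in G) && ([set v; w] \in G)]|.

(* Law of the random triangle removal process: probability that the complete
   trajectory (sequence of removed triangles, until triangle-free) satisfies E,
   started from G.  At each step a uniformly random triangle is removed.
   [fuel] bounds the number of steps; n*n suffices from K_n. *)
Fixpoint prob_from (R : realType) (n : nat) (fuel : nat) (G : {set {set 'I_n}})
    (E : seq {set 'I_n} -> bool) {struct fuel} : R :=
  if #|triangles G| == 0%N then (E [::])%:R else
  match fuel with
  | 0 => 0
  | k.+1 => \sum_(T in triangles G)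
              (#|triangles G|%:R)^-1 * prob_from R k (remove_tri G T)
                 (fun s => E (T :: s))
  end.

Definition TRP_prob (R : realType) (n : nat) (E : seq {set 'I_n} -> bool) : R :=
  prob_from R (n * n) (complete_graph n) E.

Definition pp (R : realType) (n i : nat) : R := 1 - 6 * i%:R / (n%:R ^+ 2).

Definition codeg_event (R : realType) (n : nat) (p0 gam : R)
    (s : seq {set 'I_n}) : bool :=
  [forall i : 'I_(size s).+1, forall u : 'I_n, forall v : 'I_n,
     ((u != v) && (p0 <= pp R n i)) ==>
     (`| (codeg (graph_after (take i s)) u v)%:R - n%:R * (pp R n i) ^+ 2 |
        <= gam * (n%:R * (pp R n i) ^+ 2))].

Definition final_edges_event (R : realType) (n : nat) (e : R)
    (s : seq {set 'I_n}) : bool :=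
  (n%:R `^ e <= (#|graph_after s|)%:R).

(* Main.v *)
Require Import Defs.
From HB Require Import structures.
From mathcomp Require Import all_boot all_order all_algebra.
From mathcomp Require Import all_classical all_reals all_analysis.
From mathcomp Require Import zify ring lra.
(* Imported again so that the finite-set lemmas take precedence over their
   homonyms in [classical_sets]. *)
From mathcomp Require Import fintype finset.
Import Order.TTheory GRing.Theory Num.Theory.
Import numFieldNormedType.Exports.
Local Open Scope ring_scope.

(** Call an edge isolated if it lies in no triangle, and a triangle lone if none
    of its edges lies in another triangle.  Isolated edges survive forever, so it
    suffices to produce [theta = n^(3/2 - 6 eps)] of them.  Two drift computations
    do this, starting from the last time with [p >= p0].

    Let [E] and [Q] be the numbers of edges and triangles.  By Cauchy-Schwarz the
    mean of the excess [3 Q - E] after one step is at most [(1 - 9 / E)] times its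
    value, so [(3 Q - E) / (E (E - 3) (E - 6))] is a supermartingale.  Once
    about [n^(3/2 - eps)] edges remain, the excess is negligible compared with [E],
    hence most edges are isolated or lie in lone triangles.

    A triangle can only become lone if just before it had both an edge of degree 1
    and an edge of larger degree; removing a neighbour across the latter edge would
    isolate the former one.  With all degrees at most [d], the expected
    number of new lone triangles is therefore at most [3 d] times the expected
    number of new isolated edges.  Few isolated edges thus force few lone triangles.
    Both drifts are merged into the nonnegative function [potential] below, which
    is superharmonic as long as there are fewer than [theta] isolated edges and at
    least 1 at the end of the run if there are still fewer than [theta] of them. *)

Lemma leq_card_bigcup (I J : finType) (S : {set I}) (F : I -> {set J}) (m : nat) :
  (forall i, i \in S -> #|F i| <= m)%N -> (#|\bigcup_(i in S) F i| <= #|S| * m)%N.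
Proof.
move=> Fm; rewrite -sum_nat_const.
apply: (@big_ind2 _ _ (fun (A : {set J}) k => #|A| <= k)%N) => [|A a B b Aa Bb|i /Fm //].
- by rewrite cards0.
- by rewrite (leq_trans (leq_card_setU _ _)) // leq_add.
Qed.

(** * Edge degrees in triangles *)

Section Combinatorics.
Context {n : nat}.
Implicit Types (G : {set {set 'I_n}}) (T e : {set 'I_n}).

Definition deg G e : nat := #|[set T in triangles G | e \in pairs_of T]|.
Definition isolated_edges G : {set {set 'I_n}} := [set e in G | deg G e == 0%N].
Definition lone G : {set {set 'I_n}} :=
  [set T in triangles G | [forall e in pairs_of T, deg G e == 1%N]].
(** Only these triangles can become lone at the next step ([new_lone_mixed]), and each offers a
    chance to isolate an edge ([sum_isolated_remove]). Both drifts are measured by their number. *)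
Definition mixed G : {set {set 'I_n}} :=
  [set T in triangles G | [exists e in pairs_of T, deg G e == 1%N]
                       && [exists e in pairs_of T, (1 < deg G e)%N]].

Lemma card_pairs_of T : #|T| = 3%N -> #|pairs_of T| = 3%N.
Proof. by move=> cT; rewrite cards_draws cT. Qed.

Lemma triangle_card G T : T \in triangles G -> #|T| = 3%N.
Proof. by rewrite inE => /andP[/eqP]. Qed.

Lemma triangle_sub G T : T \in triangles G -> pairs_of T \subset G.
Proof. by rewrite inE => /andP[]. Qed.

Lemma card_triangle_pairs G T : T \in triangles G -> #|pairs_of T| = 3%N.
Proof. by move/triangle_card/card_pairs_of. Qed.

(** Two distinct pairs span at least three vertices, so their union exhausts any triangle containing
    both. *)
Lemma pairs_of_linear T T' e e' : #|T| = 3%N -> #|T'| = 3%N ->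
  e \in pairs_of T -> e \in pairs_of T' ->
  e' \in pairs_of T -> e' \in pairs_of T' -> e != e' -> T = T'.
Proof.
rewrite !inE => cT cT' /andP[eT /eqP ce] /andP[eT' _] /andP[fT /eqP cf] /andP[fT' _] ne.
have UT : e :|: e' \subset T by rewrite subUset eT.
have UT' : e :|: e' \subset T' by rewrite subUset eT'.
have cU : (3 <= #|e :|: e'|)%N.
  rewrite ltnNge; apply/negP => le2.
  have E1 : e = e :|: e' by apply/eqP; rewrite eqEcard subsetUl ce.
  have E2 : e' = e :|: e' by apply/eqP; rewrite eqEcard subsetUr cf.
  by move: ne; rewrite {1}E1 -E2 eqxx.
have -> : T = e :|: e' by apply/esym/eqP; rewrite eqEcard UT cT.
by apply/eqP; rewrite eqEcard UT' cT'.
Qed.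

(** * Effect of removing one triangle *)

Lemma triangles_remove G T T' :
  (T' \in triangles (remove_tri G T)) =
  (T' \in triangles G) && [disjoint pairs_of T' & pairs_of T].
Proof. by rewrite !inE /remove_tri subsetD andbA. Qed.

Lemma deg_remove G T e : (deg (remove_tri G T) e <= deg G e)%N.
Proof.
apply/subset_leq_card/subsetP => T'.
by rewrite in_set triangles_remove => /andP[/andP[TG _] eT]; rewrite in_set TG.
Qed.

Lemma card_remove G T : T \in triangles G -> (#|remove_tri G T| + 3 = #|G|)%N.
Proof.
move=> TG; rewrite /remove_tri cardsD (setIidPr (triangle_sub _ _ TG)).
by rewrite (card_triangle_pairs _ _ TG) subnK // -(card_triangle_pairs _ _ TG) subset_leq_card // triangle_sub.
Qed.

Lemma deg_gt0 G T e : T \in triangles G -> e \in pairs_of T -> (0 < deg G e)%N.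
Proof. by move=> TG eT; rewrite card_gt0; apply/set0Pn; exists T; rewrite in_set TG. Qed.

Lemma isolated_remove G T : T \in triangles G ->
  isolated_edges G \subset isolated_edges (remove_tri G T).
Proof.
move=> TG; apply/subsetP => e; rewrite 2!in_set => /andP[eG /eqP d0].
have := deg_remove G T e; rewrite d0 leqn0 => ->; rewrite andbT in_setD eG andbT.
by apply/negP => eT; have := deg_gt0 _ _ _ TG eT; rewrite d0.
Qed.

Lemma sum_pairs (V : nmodType) G (F : {set 'I_n} -> V) :
  \sum_(T in triangles G) \sum_(e in pairs_of T) F e = \sum_(e in G) F e *+ deg G e.
Proof.
rewrite (exchange_big_dep (fun e => e \in G)) /=; last first.
  by move=> T e TG; apply/subsetP/triangle_sub.
apply: eq_bigr => e _; rewrite -sumr_const; apply: eq_bigl => T.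
by rewrite in_set.
Qed.

Lemma sum_deg G : (\sum_(e in G) deg G e = 3 * #|triangles G|)%N.
Proof.
have := sum_pairs nat G (fun=> 1%N) => sumE.
transitivity (\sum_(T in triangles G) \sum_(e in pairs_of T) 1)%N.
  by rewrite [RHS]sumE; apply: eq_bigr => e _; rewrite -mulr_natr mul1r natn.
rewrite mulnC -sum_nat_const; apply: eq_bigr => T TG.
by rewrite sum1_card (card_triangle_pairs _ _ TG).
Qed.

Lemma sum_deg_triangle G T : T \in triangles G ->
  (\sum_(e in pairs_of T) deg G e =
   \sum_(T' in triangles G) #|pairs_of T :&: pairs_of T'|)%N.
Proof.
move=> TG; under eq_bigr do rewrite /deg -sum1dep_card.
rewrite (exchange_big_dep (fun T' => T' \in triangles G)) /=; last first.
  by move=> e T' _ /andP[].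
apply: eq_bigr => T' T'G; rewrite -sum1_card; apply: eq_bigl => e.
by rewrite in_setI T'G.
Qed.

(** Another triangle shares at most one edge with [T], so the degree sum counts each destroyed
    triangle once, except [T] itself, counted three times: hence the 2. *)
Lemma card_triangles_remove G T : T \in triangles G ->
  (#|triangles (remove_tri G T)| + \sum_(e in pairs_of T) deg G e
   <= #|triangles G| + 2)%N.
Proof.
move=> TG; rewrite sum_deg_triangle //.
rewrite (bigD1 T) //= setIid (card_triangle_pairs _ _ TG).
have -> : #|triangles (remove_tri G T)| =
  (\sum_(T' in triangles G | T' != T) [disjoint pairs_of T' & pairs_of T])%N.
  rewrite -sum1_card [RHS]big_mkcond [LHS]big_mkcond /=; apply: eq_bigr => T' _.
  rewrite triangles_remove; case: (T' \in _) => //=.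
  have [->|_] := eqVneq T' T; last by case: [disjoint _ & _].
  case: ifP => // /disjoint_setI0; rewrite setIid => T0.
  by have := card_triangle_pairs _ _ TG; rewrite T0 cards0.
have -> : #|triangles G| = (1 + \sum_(T' in triangles G | T' != T) 1)%N.
  by rewrite -sum1_card (bigD1 T).
rewrite addnCA -[leqRHS]addnAC leq_add2l -big_split leq_sum //= => T' /andP[T'G neT].
have [dj|] := boolP [disjoint _ & _].
  by rewrite setIC (disjoint_setI0 dj) cards0.
rewrite add0n => _; apply/card_le1_eqP => e e'; rewrite !in_setI => /andP[a b] /andP[c d].
apply/eqP; apply: contraNT neT => ne; apply/eqP.
by apply: (pairs_of_linear _ _ e' e); rewrite ?(triangle_card G) //; rewrite eq_sym.
Qed.

Lemma card_touching G T (d : nat) : (forall e, e \in G -> deg G e <= d)%N ->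
  T \in triangles G ->
  (#|[set T' in triangles G | ~~ [disjoint pairs_of T' & pairs_of T]]| <= 3 * d)%N.
Proof.
move=> dG TG; rewrite -(card_triangle_pairs _ _ TG) -sum_nat_const.
have : (\sum_(e in pairs_of T) deg G e <= \sum_(e in pairs_of T) d)%N.
  by apply: leq_sum => e eT; apply/dG/(subsetP (triangle_sub _ _ TG)).
apply: leq_trans; rewrite sum_deg_triangle // -sum1_card.
rewrite big_mkcond [X in (_ <= X)%N]big_mkcond; apply: leq_sum => T' _ /=.
rewrite in_set; case: (T' \in _) => //=; case: ifP => // /negP/negP.
by rewrite -setI_eq0 -card_gt0 setIC.
Qed.

(** A newly isolated edge lay in a triangle touching [T]; at most [3 * d] triangles do, with three
    edges each. This bounds the overshoot past [theta] in one step. *)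
Lemma card_isolated_remove G T (d : nat) : (forall e, e \in G -> deg G e <= d)%N ->
  T \in triangles G -> (#|isolated_edges (remove_tri G T)| <= #|isolated_edges G| + 9 * d)%N.
Proof.
move=> dG TG.
set S := [set T' in triangles G | ~~ [disjoint pairs_of T' & pairs_of T]].
have : isolated_edges (remove_tri G T) \subset isolated_edges G :|: \bigcup_(T' in S) pairs_of T'.
  apply/subsetP => e; rewrite !in_set => /andP[/andP[_ eG] /eqP/cards0_eq d0].
  rewrite eG /=; have [//|] := eqVneq (deg G e) 0%N.
  rewrite -lt0n card_gt0 => /set0Pn[T'].
  rewrite in_set => /andP[T'G eT'] /=; apply/bigcupP; exists T' => //.
  rewrite in_set T'G; apply/negP => dj.
  by have := in_set0 T'; rewrite -d0 in_set triangles_remove T'G dj eT'.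
move/subset_leq_card/leq_trans; apply; rewrite (leq_trans (leq_card_setU _ _)) // leq_add2l.
rewrite -[9%N]/(3 * 3)%N -mulnA mulnC.
apply: leq_trans (leq_card_bigcup _ _ _ _ 3%N _) _.
  by move=> T'; rewrite in_set => /andP[/card_triangle_pairs ->].
by rewrite leq_mul2r card_touching.
Qed.


(** * Expected change of isolated edges and lone triangles *)

Lemma deg_gt1_exists G T e : (1 < deg G e)%N ->
  exists T', [/\ T' \in triangles G, e \in pairs_of T' & T' != T].
Proof.
rewrite /deg (cardsD1 T) => gt1.
have /card_gt0P[T'] : (0 < #|[set T in triangles G | e \in pairs_of T] :\ T|)%N.
  by move: gt1; case: (_ \in _) => //=; rewrite add0n => /ltnW.
by rewrite in_setD1 in_set => /and3P[neT T'G eT']; exists T'.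
Qed.

Lemma deg1_unique G T T' e : deg G e = 1%N -> T \in triangles G ->
  e \in pairs_of T -> T' \in triangles G -> e \in pairs_of T' -> T = T'.
Proof.
move=> d1 TG eT T'G eT'; move/eq_leq/card_le1_eqP: d1; apply;
by rewrite in_set ?TG ?T'G.
Qed.

Lemma in_isolated_edges G e :
  (e \in isolated_edges G) = (e \in G) && (deg G e == 0%N).
Proof. by rewrite in_set. Qed.

Lemma in_remove_tri G T e : (e \in remove_tri G T) = (e \notin pairs_of T) && (e \in G).
Proof. by rewrite in_setD. Qed.

Lemma in_lone G T : (T \in lone G) =
  (T \in triangles G) && [forall e in pairs_of T, deg G e == 1%N].
Proof. by rewrite in_set. Qed.

Lemma in_mixed G T : (T \in mixed G) =
  [&& T \in triangles G, [exists e in pairs_of T, deg G e == 1%N]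
    & [exists e in pairs_of T, (1 < deg G e)%N]].
Proof. by rewrite in_set. Qed.

Lemma in_pairs_of T e : (e \in pairs_of T) = (e \subset T) && (#|e| == 2)%N.
Proof. by rewrite in_set. Qed.

(** A mixed triangle has an edge [f] of degree 1 and an edge shared with a second triangle. Removing
    the latter destroys the only triangle at [f] but keeps [f], which becomes isolated. *)
Lemma sum_isolated_remove G :
  (#|triangles G| * #|isolated_edges G| + #|mixed G|
   <= \sum_(T in triangles G) #|isolated_edges (remove_tri G T)|)%N.
Proof.
pose new T := isolated_edges (remove_tri G T) :\: isolated_edges G.
have newE T : T \in triangles G ->
  #|isolated_edges (remove_tri G T)| = (#|isolated_edges G| + #|new T|)%N.
  move=> TG; rewrite /new cardsD (setIidPr (isolated_remove _ _ TG)).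
  by rewrite subnKC // subset_leq_card // isolated_remove.
rewrite (eq_bigr _ newE) big_split /= sum_nat_const leq_add2l.
(* Pairs related by [hit] are counted twice: every mixed [T''] is hit by some [T], and each [T] hits
   at most [#|new T|] mixed triangles. *)
pose hit T T'' := [exists f in pairs_of T'', (f \in new T) && (deg G f == 1%N)].
apply: (@leq_trans (\sum_(T in triangles G) #|[set T'' in mixed G | hit T T'']|)%N).
- under [leqRHS]eq_bigr do rewrite -sum1dep_card.
  rewrite (exchange_big_dep (fun T'' => T'' \in mixed G)) /=; last by move=> T T'' _ /andP[].
  rewrite -sum1_card; apply: leq_sum => T'' mT''.
  have := mT''; rewrite in_set => /and3P[T''G /exists_inP[f fT'' /eqP df] /exists_inP[e eT'' de]].
  have [T' [T'G eT' neT]] := deg_gt1_exists _ T'' _ de.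
  suff hT' : hit T' T''.
    by move: mT''; rewrite in_set => mT''; rewrite (bigD1 T') //= T'G mT'' hT'.
  apply/exists_inP; exists f => //; rewrite df eqxx andbT.
  have fe : f != e by apply: contraTneq de => <-; rewrite df.
  have fT' : f \notin pairs_of T'.
    apply: contra neT => fT'; apply/eqP.
    by apply: (pairs_of_linear _ _ f e); rewrite ?(triangle_card G).
  rewrite in_setD !in_isolated_edges df andbF in_remove_tri fT'.
  rewrite (subsetP (triangle_sub _ _ T''G) _ fT'') /=.
  rewrite cards_eq0; apply/eqP/setP => U; rewrite in_set in_set0 triangles_remove.
  apply/negP => /andP[/andP[UG dj] fU].
  have UT'' := deg1_unique _ _ _ _ df UG fU T''G fT''.
  by move: dj; rewrite UT'' => /disjointFr/(_ eT''); rewrite eT'.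
(* An edge of degree 1 lies in a single triangle, so each new isolated edge accounts for at most one
   hit. *)
apply: leq_sum => T _.
apply: (@leq_trans #|\bigcup_(f in [set f in new T | deg G f == 1%N])
   [set T'' in triangles G | f \in pairs_of T'']|).
  apply/subset_leq_card/subsetP => T''; rewrite in_set => /andP[].
  rewrite in_set => /andP[T''G _] /exists_inP[f fT'' fn].
  by apply/bigcupP; exists f; rewrite in_set ?T''G.
apply: leq_trans (_ : (#|[set f in new T | deg G f == 1%N]| * 1 <= _)%N).
  by apply: leq_card_bigcup => f; rewrite in_set => /andP[_ /eqP <-].
by rewrite muln1 subset_leq_card //; apply/subsetP => f; rewrite in_set => /andP[].
Qed.

(* Two vertices [e] of [U] lie outside [T], and a triangle through them cannot
   share an edge with [T]; hence removing [T] leaves the degree of [e] unchanged. *)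
Lemma new_lone_mixed G T U : T \in triangles G ->
  U \in lone (remove_tri G T) -> U \notin lone G -> U \in mixed G.
Proof.
move=> TG; rewrite !in_lone triangles_remove.
move=> /andP[/andP[UG dj] /forall_inP U1]; rewrite in_mixed UG /=.
case/forall_inPn=> e0 e0U ne1; apply/andP; split; last first.
  apply/exists_inP; exists e0 => //.
  by rewrite ltn_neqAle eq_sym ne1 (deg_gt0 _ _ _ UG).
have UT1 : (#|U :&: T| <= 1)%N.
  rewrite leqNgt; apply/negP => lt1.
  have : (0 < #|pairs_of (U :&: T)|)%N by rewrite cards_draws bin_gt0.
  case/card_gt0P => f; rewrite in_pairs_of subsetI => /andP[/andP[fU fT] cf].
  have fPU : f \in pairs_of U by rewrite in_pairs_of fU.
  by have := disjointFr dj fPU; rewrite in_pairs_of fT cf.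
have UT2 : (1 < #|U :\: T|)%N.
  by rewrite cardsD (triangle_card _ _ UG); move: UT1; case: #|_| => [|[]].
have : (0 < #|pairs_of (U :\: T)|)%N by rewrite cards_draws bin_gt0.
case/card_gt0P => e; rewrite in_pairs_of subsetD => /andP[/andP[eU eT] /eqP ce].
have eU' : e \in pairs_of U by rewrite in_pairs_of eU ce.
apply/exists_inP; exists e => //.
rewrite eqn_leq (deg_gt0 _ _ _ UG) // andbT -(eqP (U1 e eU')).
apply/subset_leq_card/subsetP => V.
rewrite [in X in X -> _]in_set [_ \in finset _]in_set triangles_remove.
move=> /andP[VG eV]; rewrite VG eV andbT /=.
rewrite -setI_eq0; apply/eqP/setP => f; rewrite in_set0 in_setI.
apply/negP => /andP[]; rewrite !in_pairs_of => /andP[fV /eqP cf] /andP[fT _].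
move: eV; rewrite in_pairs_of => /andP[eV _].
have : (#|e :|: f| <= #|V|)%N by rewrite subset_leq_card // subUset eV.
rewrite cardsU ce cf (triangle_card _ _ VG).
suff -> : e :&: f = set0 by rewrite cards0.
by apply: disjoint_setI0; apply: disjointWr eT.
Qed.

(** A triangle [U] that becomes lone is mixed and shares an edge with some [V]. Since [U] survives,
    [V] must be destroyed, so the removed triangle touches [V]: at most [3 * d] choices. *)
Lemma sum_lone_remove G (d : nat) : (forall e, e \in G -> deg G e <= d)%N ->
  (\sum_(T in triangles G) #|lone (remove_tri G T)|
   <= #|triangles G| * #|lone G| + 3 * d * #|mixed G|)%N.
Proof.
move=> dG; pose new T := lone (remove_tri G T) :\: lone G.
apply: (@leq_trans (\sum_(T in triangles G) (#|lone G| + #|new T|))%N).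
  apply: leq_sum => T TG; rewrite (leq_trans _ (leq_card_setU _ _)) //.
  by apply/subset_leq_card/subsetP => U UT; rewrite in_setU in_setD UT andbT orbN.
rewrite big_split /= sum_nat_const leq_add2l.
under eq_bigr do rewrite -sum1_card.
rewrite (exchange_big_dep (fun U => U \in mixed G)) /=; last first.
  by move=> T U TG; rewrite in_setD => /andP[UnG UT]; apply: (new_lone_mixed _ T).
rewrite mulnC -sum_nat_const; apply: leq_sum => U.
rewrite in_mixed => /and3P[UG _ /exists_inP[e eU de]].
have [V [VG eV neV]] := deg_gt1_exists _ U _ de.
apply: leq_trans (card_touching _ _ _ dG VG); rewrite sum1dep_card.
apply/subset_leq_card/subsetP => T TN.
have {TN}/andP[TG] : (T \in triangles G) && (U \in new T) by rewrite in_set in TN.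
suff touch : U \in new T -> ~~ [disjoint pairs_of T & pairs_of V].
  by move=> /touch ?; rewrite in_set TG.
rewrite in_setD => /andP[_]; rewrite in_lone triangles_remove.
move=> /andP[/andP[_ djU] /forall_inP/(_ e eU)/eqP d1].
apply: contra neV; rewrite disjoint_sym => djV; apply/eqP.
by apply: (deg1_unique _ _ _ _ d1); rewrite ?triangles_remove ?UG ?VG.
Qed.

(** Let each non-isolated edge split a unit weight equally among its triangles. A lone triangle
    receives 3, any other at most 1 + 1 + 1/2. *)
Lemma card_lone_isolated G :
  (6 * #|G| <= 6 * #|isolated_edges G| + 3 * #|lone G| + 15 * #|triangles G|)%N.
Proof.
pose F e : rat := (deg G e)%:R^-1.
have Fle e : e \in G -> (deg G e == 0%N)%:R + F e *+ deg G e = 1.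
  move=> eG; rewrite -[F e *+ _]mulr_natl /F; case: eqVneq => [->|d0]; first by rewrite mulr0n mul0r addr0.
  by rewrite mulfV ?pnatr_eq0 // add0r.
have cG : (#|G|%:R : rat) =
    #|isolated_edges G|%:R + \sum_(T in triangles G) \sum_(e in pairs_of T) F e.
  rewrite sum_pairs -sum1_card natr_sum -(eq_bigr _ Fle) big_split /=; congr (_ + _).
  rewrite -sum1dep_card natr_sum [RHS]big_mkcondr /=; apply: eq_bigr => e _.
  by case: eqP.
have Fle1 T e : T \in triangles G -> e \in pairs_of T -> F e <= 1.
  by move=> TG eT; rewrite /F invf_le1 ?ler1n ?ltr0n (deg_gt0 _ _ _ TG).
have sumF T : T \in triangles G ->
    6 * \sum_(e in pairs_of T) F e <= 15 + 3 * (T \in lone G)%:R.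
  move=> TG; have c3 := card_triangle_pairs _ _ TG.
  rewrite in_lone TG; case: (boolP [forall _ in _, _]) => [_|/forall_inPn[e eT ne]].
    have : \sum_(e in pairs_of T) F e <= \sum_(e in pairs_of T) 1.
      by apply: ler_sum => e; apply: Fle1.
    by rewrite sumr_const c3 /=; lra.
  have Fe : F e <= 2^-1.
    have gt1 : (1 < deg G e)%N by rewrite ltn_neqAle eq_sym ne (deg_gt0 _ _ _ TG).
    by rewrite /F lef_pV2 ?posrE ?ler_nat // ltr0n (ltnW gt1).
  have : \sum_(f in pairs_of T :\ e) F f <= \sum_(f in pairs_of T :\ e) 1.
    by apply: ler_sum => f; rewrite in_setD1 => /andP[_]; apply: Fle1.
  rewrite sumr_const (cardsD1 e) eT in c3 *.
  move: c3; rewrite add1n => -[->]; rewrite (big_setD1 e eT) /=; lra.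
rewrite -(ler_nat rat) [leLHS]natrM 2!(natrD _ (_ + _)%N, natrD) !(natrM _ _ #|_|).
rewrite cG mulrDr -addrA lerD2l mulr_sumr.
rewrite (le_trans (ler_sum _ sumF)) // big_split /= sumr_const -mulr_sumr.
have -> : \sum_(T in triangles G) (T \in lone G)%:R = #|lone G|%:R :> rat.
  rewrite -sum1_card natr_sum [RHS]big_mkcond [LHS]big_mkcond /=; apply: eq_bigr => T _.
  by rewrite in_lone; case: (T \in _) => //=; case: [forall _ in _, _].
by rewrite -mulr_natr; lra.
Qed.

Lemma card_nonisolated G : (#|G| <= #|isolated_edges G| + 3 * #|triangles G|)%N.
Proof.
rewrite -sum_deg -sum1dep_card -sum1_card big_mkcondr -big_split /=.
by apply: leq_sum => e _; case: (deg G e).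
Qed.

End Combinatorics.

(** * The law of the process *)

Section Probability.
Context {R : realType} {n : nat}.
Implicit Types (G : {set {set 'I_n}}) (T : {set 'I_n}) (E : seq {set 'I_n} -> bool).

Lemma mean_triangles_le G (F : {set 'I_n} -> R) (c : R) : #|triangles G| != 0%N ->
  (forall T, T \in triangles G -> F T <= c) ->
  \sum_(T in triangles G) (#|triangles G|%:R)^-1 * F T <= c.
Proof.
move=> Q0 Fc; rewrite -mulr_sumr ler_pdivrMl ?ltr0n ?lt0n //.
by rewrite mulr_natl -sumr_const; apply: ler_sum.
Qed.

Lemma prob_from_le1 k G E : prob_from R k G E <= 1.
Proof.
elim: k G E => [|k IH] G E /=; case: ifPn => // Q0; rewrite ?lern1 ?leq_b1 //.
by apply: mean_triangles_le.
Qed.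

Lemma prob_from_pred0 k G E : (forall s, ~~ E s) -> prob_from R k G E = 0.
Proof.
elim: k G E => [|k IH] G E E0 /=; rewrite (negbTE (E0 [::])); case: ifP => // _.
by rewrite big1 // => T _; rewrite IH ?mulr0 // => s; apply: E0.
Qed.

Lemma prob_from_leD k G E E1 E2 : (forall s, E s -> E1 s || E2 s) ->
  prob_from R k G E <= prob_from R k G E1 + prob_from R k G E2.
Proof.
elim: k G E E1 E2 => [|k IH] G E E1 E2 sub /=; case: ifP => _; rewrite ?addr0 //;
  try by rewrite -natrD ler_nat; move: (sub [::]); case: (E _) (E1 _) (E2 _) => [] [] [] //=; apply.
rewrite -big_split /=; apply: ler_sum => T _; rewrite -mulrDr ler_wpM2l ?invr_ge0 //.
by apply: IH => s; apply: sub.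
Qed.

Lemma prob_from_isolated k G (theta : R) : theta <= #|isolated_edges G|%:R ->
  prob_from R k G (fun s => #|foldl (@remove_tri n) G s|%:R < theta) = 0.
Proof.
elim: k G => [|k IH] G leth /=; case: ifP => // _.
1,2: by rewrite le_gtF // (le_trans leth) // ler_nat subset_leq_card //;
        apply/subsetP => e; rewrite in_isolated_edges => /andP[].
rewrite big1 // => T TG; rewrite IH ?mulr0 // (le_trans leth) // ler_nat.
by rewrite subset_leq_card // isolated_remove.
Qed.

End Probability.

(** * The superharmonic potential *)

Section Potential.
Context {R : realType} {n : nat}.
Implicit Types (G : {set {set 'I_n}}) (T : {set 'I_n}).

Definition excess G : R := 3 * #|triangles G|%:R - #|G|%:R.

(** Chosen so that [cubic (x - 3) * x = cubic x * (x - 9)], which absorbs the contraction factor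
    [1 - 9 / E] of the excess. *)
Definition cubic (x : R) : R := x * (x - 3) * (x - 6).

Lemma sum_excess_remove G :
  #|G|%:R * \sum_(T in triangles G) excess (remove_tri G T)
  <= #|triangles G|%:R * excess G * (#|G|%:R - 9).
Proof.
set E : R := #|G|%:R; set Q : R := #|triangles G|%:R.
pose S1 : R := \sum_(e in G) (deg G e)%:R.
pose S2 : R := \sum_(e in G) (deg G e)%:R ^+ 2.
have S1E : S1 = 3 * Q by rewrite /S1 -natr_sum sum_deg natrM.
(* Cauchy-Schwarz, by expanding the squared deviations of the degrees from their mean [3 Q / E]. *)
have CS : 9 * Q ^+ 2 <= E * S2.
  have [E0|E_gt0] := eqVneq #|G| 0%N.
    have G0 : G = set0 by apply/eqP; rewrite -cards_eq0 E0.
    by have := S1E; rewrite /S1 /E E0 G0 big_set0 mul0r; nra.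
  have : 0 <= \sum_(e in G) (E * (deg G e)%:R - 3 * Q) ^+ 2.
    by apply: sumr_ge0 => e _; rewrite sqr_ge0.
  have -> : \sum_(e in G) (E * (deg G e)%:R - 3 * Q) ^+ 2
      = E ^+ 2 * S2 - 6 * E * Q * S1 + 9 * Q ^+ 2 * E.
    transitivity (\sum_(e in G) (E ^+ 2 * (deg G e)%:R ^+ 2
        - 6 * E * Q * (deg G e)%:R + 9 * Q ^+ 2)).
      by apply: eq_bigr => e _; ring.
    rewrite big_split sumrB /= -2!mulr_sumr; congr (_ + _).
    by rewrite sumr_const /E [RHS]mulr_natr.
  have {}E_gt0 : 0 < E by rewrite ltr0n lt0n.
  rewrite S1E => ge0.
  have : 0 <= E * (E * S2 - 9 * Q ^+ 2) by lra.
  by rewrite pmulr_rge0 // subr_ge0.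
have Qrem : \sum_(T in triangles G) #|triangles (remove_tri G T)|%:R + S2 <= Q * (Q + 2).
  have -> : S2 = \sum_(T in triangles G) \sum_(e in pairs_of T) (deg G e)%:R.
    rewrite sum_pairs; apply: eq_bigr => e _.
    by rewrite expr2 [LHS]mulr_natr.
  rewrite -big_split /= /Q [leRHS]mulr_natl -[#|_|%:R + 2]natrD -[leRHS]sumr_const.
  apply: ler_sum => T TG; rewrite -natr_sum -natrD ler_nat.
  exact: card_triangles_remove.
have -> : \sum_(T in triangles G) excess (remove_tri G T) =
    3 * \sum_(T in triangles G) #|triangles (remove_tri G T)|%:R - Q * (E - 3).
  rewrite mulr_sumr /Q mulr_natl -sumr_const -sumrB; apply: eq_bigr => T TG.
  by rewrite /excess /E -(card_remove _ _ TG) natrD addrK.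
have E_ge0 : 0 <= E by rewrite ler0n.
have := ler_wpM2l E_ge0 Qrem; rewrite /excess -/E -/Q; nra.
Qed.

Lemma excess_ge G : - #|isolated_edges G|%:R <= excess G.
Proof.
rewrite /excess; move: (card_nonisolated G).
by rewrite -(ler_nat R) natrD natrM; lra.
Qed.

(** With [Z] isolated edges, [N] lone triangles and excess [X], [card_lone_isolated] reads
    [E <= 6 Z + 3 N + 5 X]: hence the weights 5 and 3. The weight [9 d] of [Z] offsets the drift of
    [3 N], and the constant keeps the sum nonnegative up to [Z = theta + 9 d]. *)
Definition potential (m theta : R) (d : nat) G : R :=
  2 / m * (5 * (cubic m / cubic #|G|%:R) * excess G + 3 * #|lone G|%:R
           + (5 + 9 * d%:R) * (theta + 9 * d%:R) - 9 * d%:R * #|isolated_edges G|%:R).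

Lemma le_cubic (x y : R) : 6 < x -> x <= y -> 0 < cubic x /\ cubic x <= cubic y.
Proof.
move=> x6 xy; rewrite /cubic; split; first by rewrite !mulr_gt0 //; lra.
by rewrite !ler_pM ?mulr_ge0 //; lra.
Qed.

(** The excess is at least [- Z] and its factor [r] is at most 1, so the negative terms total at
    most [(5 + 9 d) Z]. *)
Lemma potential_ge0 (m theta : R) (d : nat) G : 6 < m -> m <= #|G|%:R ->
  #|isolated_edges G|%:R <= theta + 9 * d%:R -> 0 <= potential m theta d G.
Proof.
move=> m6 mG Zle; have [gm gmG] := le_cubic _ _ m6 mG.
rewrite /potential mulr_ge0 ?divr_ge0 //; first by lra.
set r := cubic m / _; have r0 : 0 <= r by rewrite divr_ge0 // ltW // (lt_le_trans gm).
have r1 : r <= 1 by rewrite ler_pdivrMr ?mul1r // (lt_le_trans gm).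
have := excess_ge G; set Z := #|isolated_edges G|%:R in Zle *; set X := excess G => ZX.
have N0 : 0 <= #|lone G|%:R :> R by [].
have Z0 : 0 <= Z by rewrite /Z.
have rX : - Z <= r * X by nra.
have : d%:R * Z <= d%:R * (theta + 9 * d%:R) by rewrite ler_wpM2l.
nra.
Qed.

(** Here [5 X + 3 N >= m - 6 Z]; with [Z < theta <= m / 2] and the constant term, the bracket is at
    least [m / 2]. *)
Lemma potential_ge1 (m theta : R) (d : nat) G : 6 < m -> #|G|%:R = m ->
  2 * theta <= m -> #|isolated_edges G|%:R < theta -> 1 <= potential m theta d G.
Proof.
move=> m6 Gm thm Zlt; have [gm _] := le_cubic _ _ m6 (lexx m).
rewrite /potential Gm divff ?gt_eqF // mulr1 mulrAC ler_pdivlMr ?mul1r; last by lra.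
have : 6 * m <= 6 * #|isolated_edges G|%:R + 3 * #|lone G|%:R + 15 * #|triangles G|%:R.
  by have := card_lone_isolated G; rewrite -(ler_nat R) -Gm; lra.
have d0 : 0 <= d%:R :> R by [].
have : d%:R * #|isolated_edges G|%:R <= d%:R * (theta + 9 * d%:R).
  by rewrite ler_wpM2l //; lra.
by rewrite /excess Gm; lra.
Qed.

(** The excess term is handled by [cubic]. Summed over [T], lone triangles gain at most [3 d] per
    mixed triangle, with weight 3; isolated edges gain at least 1 per mixed triangle, with weight
    [- 9 d]. These cancel. *)
Lemma mean_potential_remove (m theta : R) (d : nat) G :
  6 < m -> m + 3 <= #|G|%:R -> #|triangles G| != 0%N ->
  (forall e, e \in G -> deg G e <= d)%N ->
  \sum_(T in triangles G) (#|triangles G|%:R)^-1 * potential m theta d (remove_tri G T)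
  <= potential m theta d G.
Proof.
move=> m6 mG Q0 dG; set Q : R := #|triangles G|%:R.
have Q_gt0 : 0 < Q by rewrite ltr0n lt0n.
rewrite -mulr_sumr ler_pdivrMl // /potential -mulr_sumr mulrCA ler_wpM2l ?divr_ge0 //.
  by lra.
set E : R := #|G|%:R in mG *.
have [gm _] := le_cubic _ _ m6 (lexx m).
have gE : cubic (E - 3) * E = cubic E * (E - 9) by rewrite /cubic; ring.
have [gE3 _] : 0 < cubic (E - 3) /\ cubic (E - 3) <= cubic (E - 3) by apply: le_cubic; lra.
have [gE0 _] : 0 < cubic E /\ cubic E <= cubic E by apply: le_cubic; lra.
have remE T : T \in triangles G -> #|remove_tri G T|%:R = E - 3.
  by move=> TG; rewrite /E -(card_remove _ _ TG) natrD addrK.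
rewrite (eq_bigr (fun T => 5 * (cubic m / cubic (E - 3)) * excess (remove_tri G T)
   + 3 * #|lone (remove_tri G T)|%:R + (5 + 9 * d%:R) * (theta + 9 * d%:R)
   - 9 * d%:R * #|isolated_edges (remove_tri G T)|%:R)); last first.
  by move=> T TG; rewrite remE.
rewrite sumrB !big_split /= -!mulr_sumr sumr_const -[_ *+ #|_|]mulr_natl -/Q.
have X := sum_excess_remove G; rewrite -/E -/Q in X.
have := sum_lone_remove G d dG; rewrite -(ler_nat R) natr_sum => N.
have := sum_isolated_remove G; rewrite -(ler_nat R) natr_sum => Z.
set sX := \sum_(T in _) excess _ in X *.
set sN := \sum_(T in _) _ in N *; set sZ := \sum_(T in _) _ in Z *.
have {}X : cubic m / cubic (E - 3) * sX <= Q * (cubic m / cubic E * excess G).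
  have E_gt0 : 0 < E by lra.
  rewrite mulrAC ler_pdivrMr //.
  have -> : Q * (cubic m / cubic E * excess G) * cubic (E - 3) =
      cubic m * (Q * excess G * (cubic (E - 3) / cubic E)).
    by move: (cubic m) (cubic E) (cubic (E - 3)) (excess G) => a b c x; ring.
  have -> : cubic (E - 3) / cubic E = (E - 9) / E.
    have [nzE nzc] : E != 0 /\ cubic E != 0 by rewrite !gt_eqF.
    by apply/eqP; rewrite eqr_div // gE mulrC.
  by rewrite ler_pM2l // mulrA ler_pdivlMr // mulrC.
have N' : sN <= Q * #|lone G|%:R + 3 * d%:R * #|mixed G|%:R.
  by rewrite (le_trans N) // natrD !natrM.
have Z' : Q * #|isolated_edges G|%:R + #|mixed G|%:R <= sZ.
  by rewrite (le_trans _ Z) // natrD natrM.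
have dZ : d%:R * (Q * #|isolated_edges G|%:R + #|mixed G|%:R) <= d%:R * sZ.
  by rewrite ler_wpM2l.
have -> : 5 * (cubic m / cubic (E - 3)) * sX = 5 * (cubic m / cubic (E - 3) * sX) by ring.
have -> : Q * (5 * (cubic m / cubic E) * excess G + 3 * #|lone G|%:R
   + (5 + 9 * d%:R) * (theta + 9 * d%:R) - 9 * d%:R * #|isolated_edges G|%:R)
   = 5 * (Q * (cubic m / cubic E * excess G)) + 3 * (Q * #|lone G|%:R)
   + Q * ((5 + 9 * d%:R) * (theta + 9 * d%:R)) - 9 * (d%:R * (Q * #|isolated_edges G|%:R)).
  by ring.
lra.
Qed.

(** Optional stopping, by induction on the [k] removals left before [m] edges remain. Once [theta]
    edges are isolated the event is impossible, and the potential is still nonnegative. *)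
Lemma prob_few_edges_le (m theta : R) (d k fuel : nat) G :
  6 < m -> 2 * theta <= m -> #|G|%:R = m + 3 * k%:R ->
  (forall e, e \in G -> deg G e <= d)%N ->
  #|isolated_edges G|%:R <= theta + 9 * d%:R ->
  prob_from R fuel G (fun s => #|foldl (@remove_tri n) G s|%:R < theta)
  <= potential m theta d G.
Proof.
move=> m6 thm; elim: k fuel G => [|k IH] fuel G GE dG Zle.
  have Gm : #|G|%:R = m by rewrite GE mulr0 addr0.
  have [/prob_from_isolated ->|Zlt] := leP theta #|isolated_edges G|%:R.
    by apply: potential_ge0; rewrite ?Gm.
  exact: le_trans (prob_from_le1 _ _ _) (potential_ge1 _ _ _ _ m6 Gm thm Zlt).
have k0 : 0 <= k%:R :> R by [].
have mG : m + 3 <= #|G|%:R by rewrite GE -natr1; lra.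
have P0 : 0 <= potential m theta d G by apply: potential_ge0 => //; lra.
have [/prob_from_isolated -> //|Zlt] := leP theta #|isolated_edges G|%:R.
(* A run that terminates above [m] edges still has at least [theta] of them. Exhausted fuel counts
   as probability 0, so any [fuel] will do. *)
have many : (#|G|%:R < theta) = false by apply/negbTE; rewrite -leNgt; lra.
case: fuel => [|fuel] /=; case: ifPn => Q0; rewrite ?many //.
apply: le_trans (mean_potential_remove m theta d G m6 mG Q0 dG).
apply: ler_sum => T TG; rewrite ler_wpM2l ?invr_ge0 //; apply: IH.
- by have := card_remove _ _ TG => /(congr1 (@GRing.natmul R 1)); rewrite natrD GE -natr1; lra.
- move=> e; rewrite in_remove_tri => /andP[_ eG].
  by rewrite (leq_trans (deg_remove _ _ _)) // dG.
- have := card_isolated_remove _ _ _ dG TG; rewrite -(ler_nat R) natrD natrM.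
  by lra.
Qed.

End Potential.

(** * The phase with controlled co-degrees *)

Section FirstPhase.
Context {R : realType} {n : nat}.
Implicit Types (G : {set {set 'I_n}}) (T e : {set 'I_n}).

(** Adding [u] and [v] to a common neighbour [w] gives a bijection onto the triangles through the
    edge. *)
Lemma deg_codeg G (u v : 'I_n) : G \subset complete_graph n -> u != v ->
  [set u; v] \in G -> deg G [set u; v] = codeg G u v.
Proof.
move=> Gc uv eG.
pose W := [set w | ([set u; w] \in G) && ([set v; w] \in G)].
(* [[set u; u]] is a singleton, hence not an edge, so [w] differs from [u] and [v]. *)
have neW w : w \in W -> w \notin [set u; v].
  rewrite in_set => /andP[uwG vwG]; rewrite in_set2.
  have := subsetP Gc _ uwG; have := subsetP Gc _ vwG; rewrite 2!in_set 2!cards2.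
  by rewrite ![_ == w]eq_sym; case: (w == u) (w == v) => [] [].
rewrite /codeg -/W -(card_in_imset (f := fun w => w |: [set u; v])); last first.
  move=> w w' /neW wW /neW w'W eqw.
  have : w \in w' |: [set u; v] by rewrite -eqw setU11.
  by rewrite in_setU1 (negbTE wW) orbF => /eqP.
apply/eq_card => T; rewrite in_set; apply/andP/imsetP => [[TG]|[w wW ->]].
  rewrite in_pairs_of => /andP[eT _].
  have : #|T :\: [set u; v]| = 1%N.
    by rewrite cardsD (setIidPr eT) (triangle_card _ _ TG) cards2 uv.
  move/eqP/cards1P => [w Tw].
  have TE : T = w |: [set u; v].
    by rewrite -Tw -[LHS](setID _ [set u; v]) (setIidPr eT) setUC.
  have wn : w \notin [set u; v].
    by have := set11 w; rewrite -Tw in_setD => /andP[].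
  exists w => //; move: wn; rewrite in_set2 negb_or => /andP[wu wv].
  have sub := subsetP (triangle_sub _ _ TG).
  rewrite in_set; apply/andP; split; apply: sub; rewrite in_pairs_of TE cards2 [_ == w]eq_sym;
    by rewrite ?wu ?wv andbT subUset !sub1set !in_setU1 !in_set1 !eqxx ?orbT.
have wn := neW _ wW; have cT : #|w |: [set u; v]| = 3%N by rewrite cardsU1 wn cards2 uv.
split; last by rewrite in_pairs_of subsetUr cards2 uv.
rewrite in_set cT eqxx /=; apply/subsetP => f; rewrite in_pairs_of => /andP[fT /eqP cf].
(* A pair inside the triple is the triple minus one vertex, which leaves three cases. *)
have : #|(w |: [set u; v]) :\: f| = 1%N by rewrite cardsD (setIidPr fT) cT cf.
move/eqP/cards1P => [x Tx].
have xT : x \in w |: [set u; v] by have := set11 x; rewrite -Tx in_setD => /andP[].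
have {Tx} fE : f = (w |: [set u; v]) :\ x.
  by rewrite -Tx setDDr setDv set0U (setIidPr fT).
move: wW; rewrite in_set => /andP[uwG vwG].
have /norP[wu wv] : ~~ ((w == u) || (w == v)) by rewrite -in_set2.
move: xT; rewrite in_setU1 in_set2 => /or3P[] /eqP xE; rewrite fE xE.
- suff -> : (w |: [set u; v]) :\ w = [set u; v] by [].
  by rewrite setU1K.
- suff -> : (w |: [set u; v]) :\ u = [set v; w] by [].
  apply/setP => y; rewrite in_setD1 in_setU1 !in_set2.
  by have [->|] := eqVneq y u; rewrite /= ?(negbTE uv) 1?eq_sym ?(negbTE wu) // orbC.
- suff -> : (w |: [set u; v]) :\ v = [set u; w] by [].
  apply/setP => y; rewrite in_setD1 in_setU1 !in_set2.
  have [->|] := eqVneq y v; rewrite /= ?[v == _]eq_sym ?(negbTE uv) ?(negbTE wv) //.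
  by rewrite orbF orbC.
Qed.

Lemma graph_after_sub (s : seq {set 'I_n}) : graph_after s \subset complete_graph n.
Proof.
rewrite /graph_after; elim/last_ind: s => [|s T IH] //=.
by rewrite foldl_rcons (subset_trans _ IH) // subsetDl.
Qed.

Lemma prob_from_le k G (E E' : seq {set 'I_n} -> bool) : (forall s, E s -> E' s) ->
  prob_from R k G E <= prob_from R k G E'.
Proof.
move=> sub; have := @prob_from_leD R n k G E E' pred0.
by rewrite (prob_from_pred0 _ _ pred0) // addr0; apply=> s /sub ->.
Qed.

(** Co-degrees of at least 2 exclude isolated edges and lone triangles at the start, so only the
    excess term and the constant of the potential remain. *)
Lemma prob_few_edges_codeg (theta : R) (d m k fuel : nat) G :
  G \subset complete_graph n ->
  (forall u v, u != v -> 2 <= codeg G u v <= d)%N ->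
  0 <= theta -> (6 < m)%N -> 2 * theta <= m%:R -> #|G| = (m + 3 * k)%N ->
  prob_from R fuel G (fun s => #|foldl (@remove_tri n) G s|%:R < theta)
  <= 10 * d%:R * (m%:R / #|G|%:R) ^+ 2
     + 2 * (5 + 9 * d%:R) * (theta + 9 * d%:R) / m%:R.
Proof.
move=> Gc cd th0 m6 thm cG.
have dG e : e \in G -> (2 <= deg G e <= d)%N.
  move=> eG; have := subsetP Gc _ eG; rewrite in_set => /cards2P[u [v [uv eE]]].
  by rewrite eE in eG *; rewrite deg_codeg // cd.
have degd e : e \in G -> (deg G e <= d)%N by move/dG/andP=> [].
have Z0 : isolated_edges G = set0.
  apply/setP => e; rewrite in_isolated_edges in_set0; apply/negP => /andP[/dG].
  by case: (deg G e).
have N0 : lone G = set0.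
  apply/setP => T; rewrite in_lone in_set0; apply/negP => /andP[TG /forall_inP T1].
  have : (0 < #|pairs_of T|)%N by rewrite (card_triangle_pairs _ _ TG).
  case/card_gt0P => e eT; have := dG e (subsetP (triangle_sub _ _ TG) _ eT).
  by rewrite (eqP (T1 _ eT)).
have d0 : 0 <= d%:R :> R by [].
have m6R : 6 < m%:R :> R by rewrite ltr_nat.
apply: le_trans (prob_few_edges_le m%:R theta d k fuel G m6R thm _ degd _) _.
- by rewrite cG natrD natrM.
- by rewrite Z0 cards0; lra.
set E : R := #|G|%:R; have mE : m%:R <= E by rewrite ler_nat cG leq_addr.
rewrite /potential Z0 N0 !cards0 -/E !mulr0 subr0 addr0 mulrDr lerD //; last first.
  by rewrite mulrAC !mulrA mulrAC.
have X : excess G <= d%:R * E.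
  rewrite /excess -natrM -sum_deg -/E.
  have : (\sum_(e in G) deg G e <= \sum_(e in G) d)%N by apply: leq_sum.
  by rewrite sum_nat_const -(ler_nat R) natrM -/E; nra.
(* Each factor obeys [(m - j) / (E - j) <= m / E], because [m <= E]. *)
have gE : cubic m%:R / cubic E <= (m%:R / E) ^+ 3.
  have [gm gmE] := le_cubic _ _ m6R mE; have gE := lt_le_trans gm gmE.
  have E0 : 0 < E by lra.
  rewrite expr_div_n ler_pdivrMr // mulrAC ler_pdivlMr ?exprn_gt0 //.
  rewrite /cubic.
  have -> : m%:R * (m%:R - 3) * (m%:R - 6) * E ^+ 3 =
    (m%:R * E) * (((m%:R - 3) * E) * ((m%:R - 6) * E)) by ring.
  have -> : m%:R ^+ 3 * (E * (E - 3) * (E - 6)) =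
    (m%:R * E) * ((m%:R * (E - 3)) * (m%:R * (E - 6))) by ring.
  apply: ler_wpM2l; first by rewrite mulr_ge0.
  by apply: ler_pM; nra.
have E0 : 0 < E by lra.
have g0 : 0 <= cubic m%:R / cubic E.
  by have [gm gmE] := le_cubic _ _ m6R mE; rewrite divr_ge0 // ltW // (lt_le_trans gm).
set q := cubic _ / _ in gE g0 *.
have qX : q * excess G <= (m%:R / E) ^+ 3 * (d%:R * E).
  apply: (@le_trans _ _ (q * (d%:R * E))); first by rewrite ler_wpM2l.
  by rewrite ler_wpM2r // mulr_ge0 // ltW.
apply: (@le_trans _ _ (2 / m%:R * (5 * ((m%:R / E) ^+ 3 * (d%:R * E))))).
  by rewrite ler_wpM2l ?divr_ge0 //; lra.
rewrite le_eqVlt; apply/orP; left; apply/eqP; field.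
by rewrite !gt_eqF //; lra.
Qed.

(** Induction on the [k] steps left until time [N], carrying the history [s0]. At time [N] either
    the co-degree bounds hold and the assumed estimate applies, or the event fails for every
    continuation. *)
Lemma prob_codeg_few_edges (p0 gam theta delta : R) (N : nat) :
  p0 <= pp R n N -> 0 <= delta -> theta + 3 * N%:R <= 'C(n, 2)%:R ->
  (forall G fuel, G \subset complete_graph n -> (#|G| + 3 * N)%N = 'C(n, 2) ->
     (forall u v, u != v -> `|(codeg G u v)%:R - n%:R * pp R n N ^+ 2|
        <= gam * (n%:R * pp R n N ^+ 2)) ->
     prob_from R fuel G (fun s => #|foldl (@remove_tri n) G s|%:R < theta) <= delta) ->
  forall k (s0 : seq {set 'I_n}) fuel, (size s0 + k)%N = N ->
    (#|graph_after s0| + 3 * size s0)%N = 'C(n, 2) ->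
  prob_from R fuel (graph_after s0) (fun s => codeg_event p0 gam (s0 ++ s)
     && (#|graph_after (s0 ++ s)|%:R < theta)) <= delta.
Proof.
move=> p0N delta0 thN few; elim=> [|k IH] s0 fuel szN cG.
  rewrite addn0 in szN.
  pose good := [forall u : 'I_n, forall v : 'I_n, (u != v) ==>
    (`|(codeg (graph_after s0) u v)%:R - n%:R * pp R n N ^+ 2|
        <= gam * (n%:R * pp R n N ^+ 2))].
  have ev_good s : codeg_event p0 gam (s0 ++ s) -> good.
    have lt0 : (size s0 < (size (s0 ++ s)).+1)%N by rewrite size_cat ltnS leq_addr.
    move/forallP/(_ (Ordinal lt0)) => /= H; rewrite take_size_cat // szN in H.
    apply/forallP => u; apply/forallP => v; apply/implyP => uv.
    by move/forallP/(_ u)/forallP/(_ v): H; rewrite uv p0N.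
  have [/forallP g|ng] := boolP good; last first.
    by rewrite prob_from_pred0 // => s; apply: contra ng => /andP[/ev_good].
  apply: le_trans (few (graph_after s0) fuel (graph_after_sub _) _ _).
  - by apply: prob_from_le => s /andP[_]; rewrite /graph_after foldl_cat.
  - by rewrite -szN.
  - by move=> u v uv; move/forallP/(_ v)/implyP: (g u); apply.
(* A run ending before time [N] has removed fewer than [3 * N] edges, which leaves at least
   [theta]. *)
have many : (#|graph_after (s0 ++ [::])|%:R < theta) = false.
  rewrite cats0; apply/negbTE; rewrite -leNgt.
  move: thN; rewrite -szN -cG natrD [leRHS]natrD natrM.
  by have : 0 <= k.+1%:R :> R by []; lra.
case: fuel => [|fuel] /=; case: ifPn => Q0; rewrite ?many ?andbF //.
apply: mean_triangles_le => // T TG.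
have gE : remove_tri (graph_after s0) T = graph_after (rcons s0 T).
  by rewrite /graph_after foldl_rcons.
have := card_remove _ _ TG; rewrite gE => cT.
apply: le_trans (IH (rcons s0 T) fuel _ _).
- by apply: prob_from_le => s; rewrite cat_rcons.
- by rewrite size_rcons -szN addSnnS.
- by rewrite size_rcons -cG -cT; lia.
Qed.

End FirstPhase.

(** * Asymptotics *)

Section Asymptotics.
Context {R : realType}.

Lemma bin2_real (n : nat) : 2 * 'C(n, 2)%:R = n%:R * (n%:R - 1) :> R.
Proof.
case: n => [|n]; first by rewrite bin0n mulr0 mul0r.
have := mul_bin_diag n.+1 1; rewrite bin1 => /(congr1 (fun k => k%:R : R)).
by rewrite !natrM -natr1 addrK => ->.
Qed.

Lemma natr_floor (a : R) : 0 <= a -> exists k : nat, k%:R <= a /\ a < k%:R + 1.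
Proof.
by move=> /truncn_itv/andP[ka ak]; exists (Num.trunc a); rewrite natr1.
Qed.

(** Here [s] stands for [n^(1/2)] and [t] for [n^eps], so [p0 = t / s]. Rounding down makes [N] the
    last time with [p >= p0], when about [n^2 p0 / 2 = s^3 t / 2] edges are left. *)
Lemma first_phase_length (n : nat) (s t : R) : 4 <= t -> t ^+ 3 <= s -> n%:R = s ^+ 2 ->
  exists N : nat, [/\ t / s <= pp R n N, pp R n N <= 2 * (t / s)
    & s ^+ 3 * t / 4 <= 'C(n, 2)%:R - 3 * N%:R].
Proof.
move=> t4 ts ns.
have t3 : 16 * t <= t ^+ 3 by rewrite exprS mulrC ler_wpM2l //; nra.
have s64 : 64 <= s by lra.
have t_le : t <= s by lra.
have s3 : 64 * s ^+ 2 <= s ^+ 3 by rewrite (exprS s 2) ler_wpM2r ?sqr_ge0.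
have s2 : 64 * s <= s ^+ 2 by rewrite expr2 ler_wpM2r //; lra.
have big : 4 * s ^+ 3 <= s ^+ 3 * t by rewrite [leRHS]mulrC ler_wpM2r ?exprn_ge0 //; lra.
have b := bin2_real n; rewrite ns in b.
have [p0 p0s] : exists p0, p0 = t / s by exists (t / s).
have {}p0s : p0 * s = t /\ p0 = t / s by rewrite p0s divfK // gt_eqF //; lra.
case: p0s => p0s <-.
have p01 : p0 <= 1 by rewrite -(ler_pM2r (_ : 0 < s)) ?p0s ?mul1r //; lra.
have e1 : (s ^+ 2) ^+ 2 * p0 = s ^+ 3 * t by rewrite -p0s; ring.
have x2 : 0 < (s ^+ 2) ^+ 2 by rewrite !exprn_gt0 //; lra.
have [|N [Na aN]] := @natr_floor ((s ^+ 2) ^+ 2 * (1 - p0) / 6).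
  by rewrite divr_ge0 // mulr_ge0 ?subr_ge0 // ltW.
exists N.
have ppE : (s ^+ 2) ^+ 2 * (1 - 6 * N%:R / (s ^+ 2) ^+ 2) = (s ^+ 2) ^+ 2 - 6 * N%:R.
  by rewrite mulrBr mulr1 mulrCA divff ?mulr1 // gt_eqF.
split.
- suff : (s ^+ 2) ^+ 2 * p0 <= (s ^+ 2) ^+ 2 * pp R n N by rewrite ler_pM2l.
  by rewrite /pp ns ppE; lra.
- suff : (s ^+ 2) ^+ 2 * pp R n N <= (s ^+ 2) ^+ 2 * (2 * p0) by rewrite ler_pM2l.
  by rewrite /pp ns ppE; lra.
- lra.
Qed.

(** The first term is [O(t^-2)]. In the second, [d theta / m] is [O(t^-3)] and [d^2 / m] is
    [O(t^5 / s^3)], which is small by [t ^+ 3 <= s]. *)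
Lemma error_terms_le (s t theta d m E : R) : 4 <= t -> t ^+ 3 <= s ->
  theta = s ^+ 3 / t ^+ 6 -> 0 <= d -> d <= 6 * t ^+ 2 ->
  s ^+ 3 / t <= m -> m <= 2 * (s ^+ 3 / t) -> s ^+ 3 * t / 4 <= E ->
  10 * d * (m / E) ^+ 2 + 2 * (5 + 9 * d) * (theta + 9 * d) / m <= 10330 / t.
Proof.
move=> t4 ts thE d0 d_le m_ge m_le E_ge.
have t_gt0 : 0 < t by lra.
have s_gt0 : 0 < s by rewrite (lt_le_trans _ ts) // exprn_gt0.
have [y yE] : exists y, y = s ^+ 3 / t by exists (s ^+ 3 / t).
have yt : y * t = s ^+ 3 by rewrite yE divfK ?gt_eqF.
have y_gt0 : 0 < y by rewrite yE divr_gt0 ?exprn_gt0.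
rewrite -yE in m_ge m_le; rewrite -{}yt in thE E_ge.
have E_gt0 : 0 < E by rewrite (lt_le_trans _ E_ge) // divr_gt0 // !mulr_gt0.
have m_gt0 : 0 < m by lra.
have thy : theta * t ^+ 5 = y by rewrite thE; field; rewrite gt_eqF.
have th0 : 0 <= theta by rewrite thE divr_ge0 ?mulr_ge0 ?exprn_ge0 // ltW.
have r_le : m / E <= 8 / t ^+ 2.
  rewrite ler_pdivrMr //.
  apply: (@le_trans _ _ (8 / t ^+ 2 * (y * t * t / 4))); last first.
    by rewrite ler_wpM2l // divr_ge0 // exprn_ge0 // ltW.
  have -> // : 8 / t ^+ 2 * (y * t * t / 4) = 2 * y by field; rewrite gt_eqF.
have r_ge : 0 <= m / E by rewrite divr_ge0 // ltW.
have t16 : 16 <= t ^+ 2 by rewrite expr2; nra.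
have iv0 : 0 < t^-1 by rewrite invr_gt0.
have iv1 : t^-1 <= 1 by rewrite invf_le1 //; lra.
have first_term : d * (m / E) ^+ 2 <= 384 * t^-1.
  apply: (@le_trans _ _ (6 * t ^+ 2 * (8 / t ^+ 2) ^+ 2)).
    apply: ler_pM; [by []|by rewrite sqr_ge0|by []|].
    by apply: lerXn2r => //; rewrite nnegrE divr_ge0 // sqr_ge0.
  have -> : 6 * t ^+ 2 * (8 / t ^+ 2) ^+ 2 = 384 * (t^-1 * t^-1).
    by field; rewrite gt_eqF.
  have : t^-1 * t^-1 <= t^-1 by rewrite ler_piMr // ltW.
  by clear; lra.
have second_term : (5 + 9 * d) * (theta + 9 * d) / m <= 3245 * t^-1.
  (* [59 = 5 + 54], where [9 * d <= 54 * t ^+ 2]. *)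
  apply: (@le_trans _ _ ((59 * t ^+ 2) * (theta + 54 * t ^+ 2) / y)).
    apply: ler_pM.
    - by rewrite mulr_ge0 // addr_ge0 // mulr_ge0.
    - by rewrite invr_ge0 ltW.
    - by clear -d0 d_le th0 t16; apply: ler_pM; lra.
    - by rewrite lef_pV2.
  have A1 : t ^+ 2 * theta / y <= t^-1.
    rewrite ler_pdivrMr // [leRHS]mulrC ler_pdivlMr // -thy mulrAC -exprSr mulrC.
    by rewrite ler_wpM2l // ler_weXn2l //; lra.
  have A2 : t ^+ 4 / y <= t^-1.
    rewrite ler_pdivrMr // [leRHS]mulrC yE !ler_pdivlMr //.
    have -> : t ^+ 4 * t * t = (t ^+ 3) ^+ 2 by ring.
    apply: (@le_trans _ _ (s ^+ 2)).
      by rewrite lerXn2r ?nnegrE // ltW ?exprn_gt0.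
    rewrite (exprS s 2) ler_peMl ?sqr_ge0 // (le_trans _ ts) // exprn_ege1 //.
    by clear -t4; lra.
  have -> : 59 * t ^+ 2 * (theta + 54 * t ^+ 2) / y =
      59 * (t ^+ 2 * theta / y) + 3186 * (t ^+ 4 / y) by field; rewrite gt_eqF.
  by clear -A1 A2; lra.
(* [10330 = 10 * 384 + 2 * 3245]. *)
by clear -first_term second_term; lra.
Qed.

End Asymptotics.

Lemma prob_codeg_few_edges_le (R : realType) (n : nat) (s t gam : R) :
  4 <= t -> t ^+ 3 <= s -> n%:R = s ^+ 2 -> gam <= 1 / 2 ->
  TRP_prob R (fun w => @codeg_event R n (t / s) gam w
     && (#|graph_after w|%:R < s ^+ 3 / t ^+ 6)) <= 10330 / t.
Proof.
move=> t4 ts ns gam2.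
have err := fun theta d m E => error_terms_le s t theta d m E t4 ts.
have K0 : 0 <= 10330 :> R by exact: ler0n.
move: (10330 : R) K0 err => K K0 err.
have [N [pp_ge pp_le C_ge]] := first_phase_length n s t t4 ts ns.
have t_gt0 : 0 < t by lra.
have t16 : 16 <= t ^+ 2 by rewrite expr2; clear -t4; nra.
have s_ge : 16 * t <= s by rewrite (le_trans _ ts) // exprSr ler_wpM2r // ltW.
have s_gt0 : 0 < s by lra.
have s2 : 64 * s <= s ^+ 2 by rewrite expr2 ler_wpM2r //; lra.
have s3 : 64 * s ^+ 2 <= s ^+ 3 by rewrite (exprS s 2) ler_wpM2r ?sqr_ge0 //; lra.
have [y yE] : exists y, y = s ^+ 3 / t by exists (s ^+ 3 / t).
have yt : y * t = s ^+ 3 by rewrite yE divfK ?gt_eqF.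
have y_ge : 64 <= y by rewrite yE ler_pdivlMr //; lra.
have y_le : y <= s ^+ 3 * t / 4.
  by have := ler_wpM2l (le_trans (ler0n _ 64) y_ge) t16; rewrite -yt; clear -y_ge; lra.
have [theta thE] : exists theta, theta = s ^+ 3 / t ^+ 6 by exists (s ^+ 3 / t ^+ 6).
have th0 : 0 <= theta by rewrite thE divr_ge0 // exprn_ge0 // ltW.
have thy : theta * t ^+ 5 = y by rewrite thE yE; field; rewrite gt_eqF.
have t5 : 2 <= t ^+ 5.
  by apply: (@le_trans _ _ t); [lra | rewrite ler_eXnr //; lra].
have th_y : 2 * theta <= y by rewrite -thy mulrC ler_wpM2l.
rewrite /TRP_prob -/(graph_after [::]) -thE -yE in err *.
clear s2 s3 s_ge t5 thy yt.
have N_le : (3 * N <= 'C(n, 2))%N.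
  by rewrite -(ler_nat R) natrM; clear -y_le y_ge C_ge; lra.
have [E0 E0E] : exists E0, E0 = ('C(n, 2) - 3 * N)%N by exists ('C(n, 2) - 3 * N)%N.
have E0R : E0%:R = 'C(n, 2)%:R - 3 * N%:R :> R by rewrite E0E natrB // natrM.
rewrite -E0R in C_ge.
(* The second phase removes [k] triangles, as many as keep [m = E0 - 3 k] at least [y]; hence
   [m < y + 3]. *)
have [|k [kb bk]] := @natr_floor R ((E0%:R - y) / 3).
  by rewrite divr_ge0 // subr_ge0 (le_trans y_le).
have k_le : (3 * k <= E0)%N by rewrite -(ler_nat R) natrM; clear -kb y_ge; lra.
have [m mE] : exists m, m = (E0 - 3 * k)%N by exists (E0 - 3 * k)%N.
have mR : m%:R = E0%:R - 3 * k%:R :> R by rewrite mE natrB // natrM.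
have m_ge : y <= m%:R by clear -mR kb; lra.
have m_le : m%:R <= 2 * y by clear -mR bk y_ge; lra.
(* Co-degrees are at most [3 / 2] times [4 t^2], since [p <= 2 t / s], and at least
   [t^2 / 2 >= 8]. *)
have [|d [d_le d_gt]] := @natr_floor R (6 * t ^+ 2); first by rewrite mulr_ge0 // sqr_ge0.
apply: (@prob_codeg_few_edges R n (t / s) gam theta (K / t) N pp_ge _ _ _ N [::]) => //.
- by rewrite divr_ge0 // ltW.
- by clear -E0R C_ge y_le th_y th0; lra.
- move=> G fuel Gc cG cd.
  have cGE : #|G| = E0 by rewrite E0E -cG addnK.
  apply: (le_trans (@prob_few_edges_codeg R n theta d m k fuel G Gc _ th0 _ _ _)).
  + move=> u v uv; have := cd u v uv.
    have x0 : n%:R * (t / s) ^+ 2 = t ^+ 2 by rewrite ns; field; rewrite gt_eqF.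
    have p_ge0 : 0 <= t / s by rewrite divr_ge0 // ltW.
    have z_ge : t ^+ 2 <= n%:R * pp R n N ^+ 2.
      rewrite -x0; apply: ler_wpM2l => //.
      by apply: lerXn2r => //; rewrite nnegrE // (le_trans p_ge0).
    have z_le : n%:R * pp R n N ^+ 2 <= 4 * t ^+ 2.
      have -> : 4 * t ^+ 2 = n%:R * (2 * (t / s)) ^+ 2 by rewrite -x0; ring.
      apply: ler_wpM2l => //.
      by apply: lerXn2r => //; rewrite nnegrE; [exact: le_trans pp_ge | exact: mulr_ge0].
    move: (n%:R * _ ^+ 2) z_ge z_le => z z_ge z_le.
    rewrite ler_norml => /andP[c1 c2].
    have gz : gam * z <= 1 / 2 * z by rewrite ler_wpM2r // (le_trans _ z_ge) ?sqr_ge0.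
    apply/andP; split; first by rewrite -(ler_nat R); clear -c1 gz z_ge t16; lra.
    by rewrite -ltnS -(ltr_nat R) -natr1; clear -c2 gz z_le d_gt; lra.
  + by rewrite -(ltr_nat R); clear -y_ge m_ge; lra.
  + exact: le_trans m_ge.
  + by rewrite cGE mE subnK.
  by rewrite cGE; apply: err.
- by rewrite muln0 addn0 card_draws card_ord.
Qed.


(** * Passage to the limit *)

Local Open Scope classical_set_scope.

Theorem theorem6p1 (R : realType) (eps : R) :
  0 < eps -> eps < 1 / 6 ->
  (exists gam : nat -> R, gam @ \oo --> (0 : R) /\
     (fun n : nat => @TRP_prob R n
         (@codeg_event R n (n%:R `^ (- (1 / 2) + eps)) (gam n)))
       @ \oo --> (1 : R)) ->
  exists del : nat -> R, del @ \oo --> (0 : R) /\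
     (fun n : nat => @TRP_prob R n
         (@final_edges_event R n (3 / 2 - 6 * eps - del n)))
       @ \oo --> (1 : R).
Proof.
move=> eps0 eps6 [gam [gam0 codeg1]].
(* The bound is reached with the exact exponent, so the error term can be 0. *)
exists (fun=> 0); split; first exact: cvg_cst.
have teps : (fun n : nat => n%:R `^ (- eps)) @ \oo --> (0 : R).
  apply/cvgr0Pnorm_lt => e e0; near=> n.
  have big : e `^ (- eps^-1) < n%:R by near: n; exact: nbhs_infty_gtr.
  rewrite ger0_norm ?powR_ge0 // powRN -[ltRHS]invrK ltf_pV2 ?posrE ?invr_gt0 //; last first.
    by rewrite powR_gt0 // (le_lt_trans _ big) // powR_ge0.
  have -> : e^-1 = (e `^ (- eps^-1)) `^ eps.
    by rewrite -powRrM mulNr mulVf ?gt_eqF // powRN powRr1 // ltW.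
  by apply: gt0_ltr_powR big => //; rewrite nnegrE ?powR_ge0.
have bad := @prob_codeg_few_edges_le R; move: (10330 : R) bad => K bad.
have lower : (fun n : nat => TRP_prob R (@codeg_event R n (n%:R `^ (- (1 / 2) + eps)) (gam n))
    - K * n%:R `^ (- eps)) @ \oo --> (1 : R).
  rewrite -[X in _ --> X]subr0 -[X in _ - X](mulr0 K).
  by apply: cvgB; [exact: codeg1 | apply: cvgMr; exact: teps].
apply: squeeze_cvgr lower (cvg_cst (1 : R)).
near=> n; apply/andP; split; last exact: prob_from_le1.
have n_gt0 : (0 < n)%N by near: n; exact: nbhs_infty_gt.
have nneq0 : n%:R != 0 :> R by rewrite pnatr_eq0 -lt0n.
have n1 : 1 <= n%:R :> R by rewrite ler1n.
have gam2 : gam n <= 1 / 2.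
  by near: n; apply: (cvgr_le (0 : R) gam0); lra.
have t4 : 4 <= n%:R `^ eps.
  rewrite -[leLHS]invrK -[leRHS]invrK -powRN lef_pV2 ?posrE ?invr_gt0 ?powR_gt0 ?ltr0n //.
  by near: n; apply: (cvgr_le (0 : R) teps); rewrite invr_gt0.
set t := n%:R `^ eps in t4 *; pose s : R := n%:R `^ (1 / 2).
have ns : n%:R = s ^+ 2.
  by rewrite /s -powR_mulrn ?powR_ge0 // -powRrM divfK ?powRr1.
(* This is [3 * eps <= 1 / 2], from [eps < 1 / 6]. *)
have ts : t ^+ 3 <= s.
  by rewrite /t -powR_mulrn ?powR_ge0 // -powRrM ler_powR //; lra.
have p0E : n%:R `^ (- (1 / 2) + eps) = t / s.
  by rewrite addrC powRB // nneq0 implybT.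
have thE : n%:R `^ (3 / 2 - 6 * eps - 0) = s ^+ 3 / t ^+ 6.
  rewrite subr0 powRB ?nneq0 ?implybT //.
  rewrite /s /t -!powR_mulrn ?powR_ge0 // -!powRrM.
  by congr (_ `^ _ / _ `^ _); lra.
rewrite p0E powRN -/t lerBlDr addrC.
(* A run satisfying the co-degree event either ends with few edges, which is unlikely, or meets the
   conclusion. *)
apply: le_trans (lerD (bad n s t (gam n) t4 ts ns gam2) (lexx _)).
apply: prob_from_leD => w cw.
by rewrite cw /= /final_edges_event thE ltNge orNb.
Unshelve. all: by end_near.
Qed.
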